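(* Let $G$ and $H$ be two non-Engel groups such that $\mathcal{E}_G\cong\mathcal{E}_H$ (isomorphic as graphs). If $G$ is finite, then $H$ is also a finite group. Moreover, $|L(H)|$ divides $|G|-|L(G)|$.
   Context: For elements of a group, $[x,y]=x^{-1}y^{-1}xy$, and $[x,_k y]$ is defined by $[x,_0 y]=x$, $[x,_k y]=[[x,_{k-1}y],y]$ for $k\ge 1$. An element $x\in G$ is left Engel if for every $a\in G$ there is a positive integer $k$ with $[a,_k x]=1$; $L(G)$ is the set of left Engel elements of $G$. $G$ is an Engel group if $L(G)=G$, and non-Engel otherwise. For a non-Engel group $G$, the Engel graph $\mathcal{E}_G$ is the simple graph with vertex set $G\setminus L(G)$ in which two distinct vertices $x,y$ are adjacent iff $[x,_k y]\neq 1$ and $[y,_k x]\neq 1$ for all positive integers $k$. *)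

(* Defs.v *)
From HB Require Import structures.
From mathcomp Require Import all_boot finmap all_classical.

Set Implicit Arguments.
Unset Strict Implicit.
Unset Printing Implicit Defensive.

Local Open Scope group_scope.
Local Open Scope classical_set_scope.

Record simple_graph := SimpleGraph {
  vertex : Type;
  adj : vertex -> vertex -> Prop;
  adj_sym : forall x y, adj x y -> adj y x;
  adj_irrefl : forall x, ~ adj x x
}.

Definition graph_isomorphic (X Y : simple_graph) : Prop :=
  exists2 f : vertex X -> vertex Y,
    bijective f & forall x y, adj x y <-> adj (f x) (f y).

Section Engel.
Variable G : groupType.

(* [x,_k y], with the library convention [~ x, y] = x^-1 * (y^-1 * (x * y)). *)
Definition iter_commg (k : nat) (x y : G) : G :=
  iter k (fun z => [~ z, y]) x.

Definition left_engel : set G :=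
  [set x | forall a : G, exists2 k : nat, (0 < k)%N & iter_commg k a x = 1].

Definition engel_group : Prop := left_engel = setT.

Definition engel_adj (x y : G) : Prop :=
  x <> y /\
  forall k : nat, (0 < k)%N -> iter_commg k x y <> 1 /\ iter_commg k y x <> 1.

Lemma engel_adj_sym (x y : G) : engel_adj x y -> engel_adj y x.
Proof.
move=> [xy nxy]; split=> [/esym //|k k0].
by have [] := nxy k k0; split.
Qed.

Lemma engel_adj_irrefl (x : G) : ~ engel_adj x x.
Proof. by case. Qed.

Definition engel_graph : simple_graph :=
  @SimpleGraph (set_type (~` left_engel))
    (fun x y => engel_adj (val x) (val y))
    (fun x y => @engel_adj_sym (val x) (val y))
    (fun x => @engel_adj_irrefl (val x)).

End Engel.

Arguments left_engel G : clear implicits.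
Arguments engel_group G : clear implicits.
Arguments engel_graph G : clear implicits.

(* Main.v *)
From HB Require Import structures.
Require Import Defs.
From mathcomp Require Import finmap all_classical all_boot all_fingroup.
From mathcomp Require Import all_solvable.

(** The graph isomorphism matches the vertex sets, so H has finitely many
    elements outside L(H), as many as G has outside L(G).

    Finiteness of H.  Write B for the complement of L(H), a finite nonempty set
    stable under conjugation, and K for its centralizer.  The quotient of H by K
    acts faithfully on B by conjugation, so it is enough that K is finite.  For
    x in B and k in K the product x k stays in B: [a,_n x] commutes with K and
    [a,_n k] lies in K for n > 0, whence [a,_n xk] = [a,_n x] [a,_n k]
    ([mul_centralizer_not_left_engel]); as k is left Engel, the second factor
    eventually disappears, so the left Engel condition for x k would give the
    one for x.  Thus x K is a subset of B, and K is finite.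

    Divisibility.  In a finite group the left Engel elements form the Fitting
    subgroup (Baer's theorem, [left_engel_FittingP]).  By Lagrange, |L(H)|
    divides |H|, hence also |H| - |L(H)| = |G| - |L(G)|.

    Baer's theorem.  In a minimal counterexample A, some left Engel x is outside
    F(A) although the left Engel elements of any proper subgroup M lie in F(M).
    The nilpotent groups that they generate can then be glued, in the
    manner of Wielandt's zipper lemma: all left Engel elements that
    share a proper subgroup with x lie in one proper subgroup M
    ([greatest_proper_trace]).  If N is the normalizer in A of the set of left
    Engel elements of M, then [a, x] in N forces a in N; so the commutators
    [a,_k x] with a outside N never enter N, and in particular never become
    trivial ([minimal_not_left_engel]). *)

Set Implicit Arguments.
Unset Strict Implicit.
Unset Printing Implicit Defensive.

Local Open Scope group_scope.

(** * Iterated commutators *)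

Section IteratedCommutators.
Variable G : groupType.
Implicit Types a g x y z u v k : G.

Lemma commute_conjg x y g : commute x y -> commute (x ^ g) (y ^ g).
Proof. by rewrite /commute -!conjMg => ->. Qed.

Lemma commuteR x y z : commute x y -> commute x z -> commute x [~ y, z].
Proof.
move=> xy xz; rewrite commgEl conjgE.
by apply/commuteM/commuteM/commuteM; [apply: commuteV | apply: commuteV | |].
Qed.

Lemma commgMM u v x k :
    commute u v -> commute u k -> commute x v -> commute x k ->
  [~ u * v, x * k] = [~ u, x] * [~ v, k].
Proof.
move=> uv uk xv xk.
have comR (a b : G) : [~ a, b] = (b * a)^-1 * (a * b).
  by rewrite commgEl conjgE invgM !mulgA.
have com_ux : commute (k * v)^-1 [~ u, x].
  apply/commute_sym/commuteV/commuteM; apply/commute_sym/commuteR;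
    exact/commute_sym.
have uvxk : u * v * (x * k) = u * x * (v * k).
  by rewrite !mulgA -(mulgA u) -xv !mulgA.
have xkuv : x * k * (u * v) = x * u * (k * v).
  by rewrite !mulgA -(mulgA x) -uk !mulgA.
transitivity ((k * v)^-1 * [~ u, x] * (v * k)).
  by rewrite !comR uvxk xkuv invgM !mulgA.
by rewrite com_ux (comR v) !mulgA.
Qed.

Lemma iter_commgS n a x : iter_commg n.+1 a x = [~ iter_commg n a x, x].
Proof. by []. Qed.

Lemma iter_commg1 n x : iter_commg n 1 x = 1.
Proof. by elim: n => // n; rewrite iter_commgS => ->; rewrite comm1g. Qed.

Lemma iter_commgJ n a x g : iter_commg n (a ^ g) (x ^ g) = iter_commg n a x ^ g.
Proof. by elim: n => // n IHn; rewrite !iter_commgS IHn conjRg. Qed.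

Lemma left_engelJ x g : left_engel G x -> left_engel G (x ^ g).
Proof.
move=> engx a; have [k k0 ax1] := engx (a ^ g^-1); exists k => //.
by rewrite -(conjgKV g a) iter_commgJ ax1 conj1g.
Qed.

End IteratedCommutators.

(** * Baer's theorem: left Engel elements of a finite group *)

Section FiniteGroups.
Variable gT : finGroupType.
Implicit Types (A D M K T X : {group gT}) (C S I : {set gT}).

(** The normalizer condition for nilpotent groups, transferred from subgroups
    to the part of a normal subset S that they contain: enlarge <<I>> to a
    largest subgroup X of D that meets S exactly in I; the normalizer of X in D
    is larger than X, so it meets S in more than I, and it fixes X :&: S. *)
Lemma nilpotent_normalizer_grows D S I :
    nilpotent D -> S \subset D -> D \subset 'N(S) -> I \proper S ->
    <<I>> :&: S = I ->
  exists2 d, d \in S :\: I & d \in 'N(I).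
Proof.
move=> nilD sSD nSD /properP[sIS [s Ss nIs]] capI.
have [X maxX _] : {X : {group gT}
    | [max X of X | (X \subset D) && (X :&: S == I)] & <<I>>%G \subset X}.
  by apply: maxgroup_exists; rewrite gen_subG (subset_trans sIS sSD) /= capI.
have /maxgroupP[/andP[sXD /eqP defI] maxP] := maxX.
have prXD : X \proper D.
  rewrite properEneq sXD andbT; apply: contra nIs => /eqP eqXD.
  by rewrite -defI eqXD inE Ss (subsetP sSD).
have prXN := nilpotent_proper_norm nilD prXD.
have nIN : 'N_D(X) \subset 'N(I).
  rewrite -defI; apply: subset_trans (normsI (subsetIr _ _) _) => //.
  exact: subset_trans (subsetIl _ _) nSD.
have [eqI | neqI] := eqVneq ('N_D(X) :&: S) I.
  have eqNX : 'N_D(X)%G = X.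
    apply/val_inj/maxP; last exact: proper_sub prXN.
    by rewrite /= subsetIl eqI eqxx.
  by move: prXN; rewrite -[in X in proper (mem X) _]eqNX properxx.
have sI : I \subset 'N_D(X) :&: S.
  by rewrite -{1}defI setSI // proper_sub.
have /subsetPn[d] : ~~ ('N_D(X) :&: S \subset I).
  by apply: contra neqI => sNI; rewrite eqEsubset sNI.
rewrite inE => /andP[Nd Sd] nId; exists d; first by rewrite inE nId.
exact: (subsetP nIN).
Qed.

Section MinimalCounterexample.
(* C stands for the set of left Engel elements; the trace of a subgroup M is
   the set C :&: M. *)
Variables (C : {set gT}) (A : {group gT}) (x : gT).
Hypothesis nC : forall g, g \in 'N(C).
Hypothesis IH : forall M, M \proper A -> C :&: M \subset 'F(M).
Hypotheses (Cx : x \in C) (Ax : x \in A) (nFx : x \notin 'F(A)).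

Lemma norm_trace M : M \subset 'N(C :&: M).
Proof. by rewrite normsI ?normG //; apply/subsetP=> g _; apply: nC. Qed.

Lemma trace_nilpotent M : M \proper A -> nilpotent <<C :&: M>>.
Proof.
by move=> /IH sCF; apply: nilpotentS (Fitting_nil M); rewrite gen_subG.
Qed.

(** Otherwise x would lie in a normal nilpotent subgroup of A. *)
Lemma norm_trace_proper M :
  M \proper A -> x \in M -> 'N_A(C :&: M) \proper A.
Proof.
move=> prM Mx; rewrite properEneq subsetIl andbT.
apply: contra nFx => /eqP/setIidPl nCM.
apply: (subsetP (Fitting_max _ (trace_nilpotent prM))).
  rewrite /normal gen_subG (subset_trans (subsetIr _ _) (proper_sub prM)).
  exact: norms_gen.
by rewrite mem_gen // inE Cx.
Qed.

(** The induction is on the number of elements of C outside the common trace I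
    of M and K.  If I is neither of the two traces, its normalizer N in A is a
    proper subgroup that meets the trace of M outside I, and likewise that of
    K.  Hence N and M have a larger common trace, so their traces lie in some
    proper subgroup T1; since T1 contains the trace of N, it shares with K a
    trace larger than I, and the induction applies once more, to T1 and K. *)
Lemma proper_traces_join M K :
    M \proper A -> K \proper A -> x \in M -> x \in K ->
  exists2 T : {group gT}, T \proper A & (C :&: M) :|: (C :&: K) \subset T.
Proof.
have [n] := ubnP (#|C| - #|C :&: (M :&: K)|).
elim: n M K => // n IHn M K le_n prM prK Mx Kx.
pose I := C :&: (M :&: K)%G.
have sIM : I \subset C :&: M by rewrite setIS // subsetIl.
have sIK : I \subset C :&: K by rewrite setIS // subsetIr.
have grow (L : {group gT}) : L \proper A -> I \proper C :&: L ->
    exists2 d, d \in (C :&: L) :\: I & d \in 'N(I).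
  move=> prL prI; have sCL : C :&: L \subset L := subsetIr _ _.
  apply: (@nilpotent_normalizer_grows (generated_group (C :&: L))) => //.
  - exact: trace_nilpotent.
  - exact: subset_gen.
  - by rewrite gen_subG (subset_trans sCL) ?norm_trace.
  apply/eqP; rewrite eqEsubset; apply/andP; split; last first.
    by rewrite subsetI subset_gen (proper_sub prI).
  rewrite subsetI (subset_trans (subsetIr _ _)) ?subsetIl //=.
  by rewrite (subset_trans (subsetIl _ _)) // gen_subG subsetIr.
have [eqIM | neqIM] := eqVneq I (C :&: M).
  exists K; rewrite // subUset subsetIr andbT -eqIM.
  by rewrite (subset_trans sIK) ?subsetIr.
have [eqIK | neqIK] := eqVneq I (C :&: K).
  exists M; rewrite // subUset subsetIr -eqIK.
  by rewrite (subset_trans sIM) ?subsetIr.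
have [d] : exists2 d, d \in (C :&: M) :\: I & d \in 'N(I).
  by apply: grow; rewrite // properEneq neqIM.
case/setDP=> /setIP[Cd Md] nId Nd.
have [e] : exists2 e, e \in (C :&: K) :\: I & e \in 'N(I).
  by apply: grow; rewrite // properEneq neqIK.
case/setDP=> /setIP[Ce Ke] nIe Ne.
have prMK : (M :&: K)%G \proper A by rewrite (sub_proper_trans (subsetIl _ _)).
pose N := 'N_A(I)%G.
have prN : N \proper A by apply: norm_trace_proper; rewrite //= inE Mx.
have sMKN : M :&: K \subset N.
  by rewrite subsetI (proper_sub prMK) norm_trace.
have Nx : x \in N by rewrite (subsetP sMKN) // inE Mx.
have larger (X Y : {group gT}) z :
    I \subset X :&: Y -> z \in C -> z \in X -> z \in Y -> z \notin I ->
  (#|C| - #|C :&: (X :&: Y)| < n)%N.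
  move=> sIXY Cz Xz Yz nIz; rewrite -ltnS; apply: leq_trans le_n; rewrite ltnS.
  have prI : I \proper C :&: (X :&: Y).
    apply/properP; split; last by exists z; rewrite // !in_setI Cz Xz.
    by rewrite subsetI subsetIl.
  apply: ltn_sub2l (proper_card prI).
  by apply: leq_trans (proper_card prI) _; rewrite subset_leq_card ?subsetIl.
have sIN : I \subset N by rewrite (subset_trans (subsetIr _ _) sMKN).
have [T1 prT1] : exists2 T : {group gT},
    T \proper A & (C :&: N) :|: (C :&: M) \subset T.
  apply: IHn => //; apply: (larger _ _ d) => //.
    by rewrite subsetI sIN (subset_trans sIM) ?subsetIr.
  by rewrite inE Nd (subsetP (proper_sub prM)).
rewrite subUset => /andP[sNT1 sMT1].
have T1x : x \in T1 by rewrite (subsetP sMT1) // inE Cx.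
have [T2 prT2] : exists2 T : {group gT},
    T \proper A & (C :&: T1) :|: (C :&: K) \subset T.
  apply: IHn => //; apply: (larger _ _ e) => //.
    by rewrite subsetI (subset_trans sIM) // (subset_trans sIK) ?subsetIr.
  by rewrite (subsetP sNT1) // inE Ce inE Ne (subsetP (proper_sub prK)).
rewrite subUset => /andP[sT12 sKT2]; exists T2 => //.
rewrite subUset sKT2 andbT (subset_trans _ sT12) // subsetI sMT1.
by rewrite subsetIl.
Qed.

Lemma greatest_proper_trace :
    (exists2 M : {group gT}, M \proper A & x \in M) ->
  exists M : {group gT}, [/\ M \proper A, x \in M
    & forall K, K \proper A -> x \in K -> C :&: K \subset M].
Proof.
case=> M0 prM0 M0x.
pose P (M : {group gT}) := (M \proper A) && (x \in M).
have PM0 : P M0 by rewrite /P prM0.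
have [M /andP[prM Mx] maxM] := arg_maxnP (fun M => #|C :&: M|) PM0.
exists M; split=> // K prK Kx.
have [T prT] := proper_traces_join prM prK Mx Kx.
rewrite subUset => /andP[sMT sKT].
have Tx : x \in T by rewrite (subsetP sMT) // inE Cx.
have /eqP eqMT : C :&: M == C :&: T.
  rewrite eqEcard subsetI subsetIl sMT /=; apply: maxM.
  by rewrite /P prT Tx.
by apply: subset_trans (subsetIr C M); rewrite eqMT subsetI subsetIl.
Qed.

(** Let S be the greatest trace and N its normalizer.  If [a, x] is in N, then
    so is x ^ a, hence x ^ a is in S; conjugating back, the trace S :^ a^-1
    belongs to a proper subgroup that contains x, so it lies in S and a
    normalizes S.  Read backwards, commutation with x never leads into N. *)
Lemma minimal_not_left_engel :
  exists2 a, a \in A & forall k, iter_commg k a x != 1.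
Proof.
have [M [prM Mx maxM]] : exists M : {group gT}, [/\ M \proper A, x \in M
    & forall K, K \proper A -> x \in K -> C :&: K \subset M].
  (* A is not cyclic: otherwise A = 'F(A) would contain x. *)
  apply: greatest_proper_trace; exists <[x]>%G; last exact: cycle_id.
  rewrite properEneq cycle_subG Ax andbT; apply: contra nFx => /eqP <-.
  by rewrite nilpotent_Fitting ?cycle_id // abelian_nil ?cycle_abelian.
pose S := C :&: M; pose N := 'N_A(S)%G.
have prN : N \proper A by exact: norm_trace_proper.
have Nx : x \in N by rewrite inE Ax (subsetP (norm_trace M)).
have sNM : C :&: N \subset M by exact: maxM.
have pull a : a \in A -> [~ a, x] \in N -> a \in N.
  move=> Aa Nax.
  have Nxa : x ^ a \in N.
    by rewrite -groupV -(groupMr _ Nx) -conjVg; move: Nax; rewrite commgEr.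
  have Mxa : x ^ a \in M.
    by rewrite (subsetP sNM) // inE Nxa andbT memJ_norm.
  have sS : S :^ a^-1 \subset S.
    rewrite subsetI; apply/andP; split.
      by rewrite -(normP (nC a^-1)) conjSg subsetIl.
    rewrite /S conjIg (normP (nC a^-1)).
    apply: (maxM (M :^ a^-1)%G); last by rewrite mem_conjgV.
    by rewrite -(conjGid (groupVr Aa)) properJ.
  by rewrite inE Aa -groupV inE; exact: sS.
have /subsetPn[a Aa nNa] : ~~ (A \subset N).
  by move: prN; rewrite properE => /andP[].
exists a => // k.
have Nk : iter_commg k a x \in A :\: N.
  elim: k => [|k]; first by rewrite inE nNa.
  case/setDP=> Ak nk; apply/setDP; rewrite iter_commgS.
  by rewrite groupR //; split=> //; apply: contra nk; apply: pull.
by apply: contraTneq Nk => ->; rewrite inE group1.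
Qed.

End MinimalCounterexample.

Lemma engel_sub_Fitting C A :
    (forall g, g \in 'N(C)) ->
    (forall x a, x \in C -> exists k, iter_commg k a x = 1) ->
  C :&: A \subset 'F(A).
Proof.
move=> nC engC; have [n] := ubnP #|A|; elim: n A => // n IHn A leA.
apply/subsetP=> x /setIP[Cx Ax]; apply: contraT => nFx.
have IH M : M \proper A -> C :&: M \subset 'F(M).
  by move=> /proper_card ltM; apply: IHn; apply: leq_trans ltM _.
have [a _ na] := minimal_not_left_engel nC IH Cx Ax nFx.
by have [k /eqP] := engC x a Cx; rewrite (negPf (na k)).
Qed.

(** Already [a, x] lies in the Fitting subgroup, since that is normal; from
    there, each commutation with x goes one step down its lower central
    series. *)
Lemma Fitting_left_engel x : x \in 'F([set: gT]) -> left_engel gT x.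
Proof.
set F := 'F(_) => Fx a.
have inL k : iter_commg k.+1 a x \in 'L_k.+1(F).
  elim: k => [|k IHk]; last by rewrite lcnSn iter_commgS mem_commg.
  rewrite lcn1 iter_commgS commgEr groupM // memJ_norm ?groupV //.
  by apply: (subsetP (normal_norm (Fitting_normal _))); rewrite inE.
have /lcnP[n Ln1] := Fitting_nil [set: gT].
by exists n.+1 => //; apply/set1P; rewrite -[[set 1]]Ln1.
Qed.

Lemma left_engel_FittingP (x : gT) : left_engel gT x <-> x \in 'F([set: gT]).
Proof.
split=> [engx | ]; last exact: Fitting_left_engel.
pose C := [set y : gT | `[< left_engel gT y >]].
have nC g : g \in 'N(C).
  rewrite inE; apply/subsetP=> _ /imsetP[y + ->].
  by rewrite !inE => /asboolP engy; apply/asboolP/left_engelJ.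
have engC y a : y \in C -> exists k, iter_commg k a y = 1.
  by rewrite inE => /asboolP/(_ a)[k _ ?]; exists k.
apply: (subsetP (engel_sub_Fitting [set: gT] nC engC)).
by rewrite !inE andbT; apply/asboolP.
Qed.

End FiniteGroups.

(** * The number of left Engel elements *)

Lemma card_fset_set_finset (T : finType) (A : {set T}) (B : classical_sets.set T) :
  (forall x, B x <-> x \in A) -> #|` fset_set B| = #|A|.
Proof.
move=> defB; rewrite -card_finset; congr (#|` _|).
apply/fsetP=> x; rewrite in_fset_set; last exact: finite_finset.
rewrite in_fset /=; apply/idP/idP => [/set_mem/defB // | /defB Bx].
exact: mem_set.
Qed.

Local Open Scope classical_set_scope.

Lemma dvdn_card_left_engel (H : groupType) :
  finite_set [set: H] ->
  (#|` fset_set (left_engel H)| %| #|` fset_set [set: H]|)%N.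
Proof.
move=> finH; pose s : seq H := fset_set [set: H].
have s_all x : x \in s by rewrite /s in_fset_set //; apply: mem_set.
have idxK : pcancel (fun x => index x s) (fun i => Some (nth 1 s i)).
  by move=> x; rewrite nth_index.
have enumP : Finite.axiom s.
  by move=> x; rewrite count_uniq_mem ?fset_uniq ?s_all.
(* H itself, with the enumeration s as its finite type structure: the group
   structure is unchanged, so that left_engel gT is left_engel H. *)
pose gT : finGroupType := HB.pack (Group.sort H)
  (Choice_isCountable.Build H idxK) (isFinite.Build H enumP).
have := cardSg (Fitting_sub [set: gT]%SET).
rewrite -(card_fset_set_finset (@left_engel_FittingP gT)).
by rewrite -(@card_fset_set_finset gT [set: gT]%SET [set: H]) //.
Qed.

(** * Groups with finitely many elements that are not left Engel *)

Definition set_centralizer (G : groupType) (B : set G) : set G :=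
  [set k | forall b, B b -> commute k b].

(** Conjugation maps G into the finite set of self-maps of B, and each fibre
    lies in a coset of the centralizer of B. *)
Lemma finite_of_finite_centralizer (G : groupType) (B : set G) :
    finite_set B -> (forall b g, B b -> B (b ^ g)) ->
    finite_set (set_centralizer B) ->
  finite_set [set: G].
Proof.
move=> finB BJ finK; pose F := fset_set B.
have FP b : (b \in F) = (b \in B) by rewrite in_fset_set.
(* The default value b of insubd never occurs, B being closed under
   conjugation. *)
pose phi g : {ffun F -> F} := [ffun b => insubd b (val b ^ g)].
have phiE g b : val (phi g b) = val b ^ g.
  rewrite ffunE val_insubd FP mem_set //; apply: BJ.
  by apply: set_mem; rewrite -FP; apply: valP.
have fin_fiber f : finite_set [set g | phi g = f].
  have [[g0 <-] | nof] := pselect (exists g, phi g = f); last first.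
    rewrite (_ : [set _ | _] = classical_sets.set0) //.
    by rewrite -classical_sets.subset0 => g eqg; case: nof; exists g.
  apply: sub_finite_set (finite_image (fun k => k * g0) finK) => g /= eqg.
  exists (g * g0^-1); last by rewrite mulgVK.
  move=> b Bb; have Fb : b \in F by rewrite FP mem_set.
  have := congr1 (fun h : {ffun F -> F} => val (h [` Fb]%fset)) eqg.
  rewrite !phiE /= => eqbg; apply/esym/commgP/conjg_fixP.
  by rewrite conjgM eqbg conjgK.
rewrite (_ : [set: G] = \bigcup_(f in [set: {ffun F -> F}]) [set g | phi g = f]).
  by apply: bigcup_finite => // *; apply: finite_finset.
by apply/seteqP; split=> // g _; exists (phi g).
Qed.

Section NonLeftEngel.
Variable G : groupType.
Local Notation B := (~` left_engel G).
Local Notation K := (set_centralizer B).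

Lemma non_left_engelJ (x g : G) : B x -> B (x ^ g).
Proof.
by move=> nx engxg; apply: nx; rewrite -(conjgK g x); apply: left_engelJ.
Qed.

Lemma centralizerJ (k g : G) : K k -> K (k ^ g).
Proof.
move=> Kk b Bb; rewrite -(conjgKV g b); apply: commute_conjg.
exact/Kk/non_left_engelJ.
Qed.

(** If k were in B, then so would be its conjugates; k would commute with all
    of them and hence with every commutator [a, k]. *)
Lemma centralizer_left_engel (k : G) : K k -> left_engel G k.
Proof.
move=> Kk; apply: contrapT => Bk; apply: (Bk) => a; exists 2%N => //.
apply/eqP/commgP; rewrite /= commgEr conjVg.
apply/commute_sym/commuteM => //; apply: commuteV.
by apply: Kk; apply: non_left_engelJ.
Qed.

(** For n > 0 the element [a,_n x] is built from conjugates of x, so it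
    commutes with K, while [a,_n k] stays in the normal subgroup K; this makes
    iterated commutators with x * k split as a product. *)
Lemma mul_centralizer_not_left_engel (x k : G) : B x -> K k -> B (x * k).
Proof.
move=> Bx Kk engxk; apply: (Bx) => a.
have split_iter n :
  [/\ iter_commg n.+1 a (x * k) = iter_commg n.+1 a x * iter_commg n.+1 a k,
      forall h, K h -> commute (iter_commg n.+1 a x) h
    & K (iter_commg n.+1 a k)].
  elim: n => [|n [eqn cKn Kn]].
    have Kak : K [~ a, k].
      move=> b Bb; apply: commute_sym; rewrite commgEr conjVg.
      apply: commuteM; last exact/commute_sym/Kk.
      by apply/commuteV/commute_sym; apply: centralizerJ.
    have cKax h : K h -> commute [~ a, x] h.
      move=> Kh; apply: commute_sym; rewrite commgEr conjVg.
      by apply: commuteM; [apply/commuteV/Kh/non_left_engelJ | apply: Kh].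
    split=> //.
    have comk : commute [~ a, x] (k^-1 ^ a).
      apply: cKax => b Bb; rewrite conjVg.
      by apply/commute_sym/commuteV/commute_sym; apply: centralizerJ.
    rewrite !iter_commgS [LHS]commgEr invgM conjMg.
    transitivity (k^-1 ^ a * [~ a, x] * k); first by rewrite commgEr !mulgA.
    by rewrite -comk [in RHS](commgEr _ k) [RHS]mulgA.
  rewrite !(iter_commgS n.+1) eqn; split.
  - apply: commgMM; [exact: cKn | exact: cKn | exact/commute_sym/Kn |].
    exact/commute_sym/Kk.
  - move=> h Kh; apply/commute_sym/commuteR; last exact: Kh.
    exact/commute_sym/cKn.
  - move=> b Bb; apply/commute_sym/commuteR; last exact/commute_sym/Kk.
    exact/commute_sym/Kn.
have stays1 n m y : iter_commg n a y = 1 -> iter_commg (m + n) a y = 1.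
  move=> eq1; rewrite /iter_commg iterD -/(iter_commg n a y) eq1.
  exact: iter_commg1.
have [n n_gt0 eq1] := engxk a.
have [m m_gt0 eqk1] := centralizer_left_engel Kk a.
exists (m + n)%N; first by rewrite addn_gt0 m_gt0.
have := split_iter (m + n).-1; rewrite prednK ?addn_gt0 ?m_gt0 // => -[+ _ _].
by rewrite (stays1 n) // [in (m + n)%N]addnC (stays1 m _ k) // mulg1 => <-.
Qed.

Lemma finite_of_finite_non_left_engel :
  ~ engel_group G -> finite_set B -> finite_set [set: G].
Proof.
move=> nonE finB.
apply: (finite_of_finite_centralizer finB) => [b g|].
  exact: non_left_engelJ.
have [x Bx] : exists x, B x.
  apply: contra_notP nonE => noB; apply/seteqP; split=> // x _.
  by apply: contrapT => Bx; apply: noB; exists x.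
apply: sub_finite_set (finite_preimage (f := fun k => x * k) _ finB).
  by move=> k Kk; apply: mul_centralizer_not_left_engel.
by move=> k h _ _ /mulgI.
Qed.

End NonLeftEngel.

(** * Comparison of the two groups *)

Lemma card_fset_setC (T : choiceType) (A : set T) :
  finite_set [set: T] ->
  #|` fset_set (~` A)| = (#|` fset_set [set: T]| - #|` fset_set A|)%N.
Proof.
move=> finT; have finA : finite_set A by apply: sub_finite_set finT.
rewrite -classical_sets.setTD fset_setD // cardfsDS //.
by apply/fsubsetP=> x _; rewrite in_fset_set // mem_set.
Qed.

Lemma graph_isomorphic_card_eq (G H : groupType) :
  graph_isomorphic (engel_graph G) (engel_graph H) ->
  (~` left_engel G #= ~` left_engel H)%card.
Proof. by case=> f bij_f _; apply/card_bijP; exists f. Qed.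

Local Open Scope fset_scope.

Theorem theorem4p2 (G H : groupType)
    (nonEngelG : ~ engel_group G) (nonEngelH : ~ engel_group H)
    (isoGH : graph_isomorphic (engel_graph G) (engel_graph H))
    (finG : finite_set [set: G]) :
  finite_set [set: H] /\
  (#|` fset_set (left_engel H)| %|
     #|` fset_set [set: G]| - #|` fset_set (left_engel G)|)%N.
Proof.
have eqV := graph_isomorphic_card_eq isoGH.
have finVG : finite_set (~` left_engel G) by apply: sub_finite_set finG.
have finVH : finite_set (~` left_engel H) by rewrite -(eq_finite_set eqV).
have finH := finite_of_finite_non_left_engel nonEngelH finVH.
split=> //; rewrite -card_fset_setC //.
have /fcard_eq-> // := eqV.
by rewrite card_fset_setC // dvdn_sub ?dvdnn ?dvdn_card_left_engel.
Qed.
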